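(* For each $\alpha\in(0,2]$, let $p=\frac{2}{\alpha}-1\ge 0$ (so that $\alpha=\frac{2}{1+p}$). The class of all solutions $\varphi$, within the class of all characteristic functions of probability distributions on the real line, of the equation $$\frac{1}{2\pi}\int_{0}^{2\pi}\varphi(\xi c_p(\theta))\,\varphi(\xi s_p(\theta))\,d\theta=\varphi(\xi)\qquad(\xi\in\mathbb{R})$$ consists of all the characteristic functions of the form $\xi\mapsto e^{-a_0|\xi|^\alpha}$ with $a_0\ge 0$.
   Context: For $p\ge 0$ and $\theta\in(0,2\pi]$ put $c_p(\theta):=\cos\theta\,|\cos\theta|^p$ and $s_p(\theta):=\sin\theta\,|\sin\theta|^p$. The characteristic function of a probability distribution $m$ on the Borel sets of $\mathbb{R}$ is $\hat m(\xi)=\int_{\mathbb{R}}e^{i\xi x}\,m(dx)$, $\xi\in\mathbb{R}$. *)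

(* Defs.v *)
From HB Require Import structures.
From mathcomp Require Import all_boot all_order all_algebra.
From mathcomp Require Import all_classical all_reals all_analysis.
From mathcomp Require Export complex.
Import Order.TTheory GRing.Theory Num.Theory.
Import numFieldNormedType.Exports.

Set Implicit Arguments.
Unset Strict Implicit.
Unset Printing Implicit Defensive.

Local Open Scope classical_set_scope.
Local Open Scope ring_scope.
Local Open Scope complex_scope.

(* The library integrates only real and extended-real functions; a complex
   function is integrated componentwise. *)
Definition Cintegral d (T : measurableType d) (R : realType)
    (mu : {measure set T -> \bar R}) (D : set T) (f : T -> R[i]) : R[i] :=
  Rintegral mu D (fun x => complex.Re (f x)) +i*
  Rintegral mu D (fun x => complex.Im (f x)).

(* e^(i t) for real t, by Euler's formula: R[i] has no exponential. *)
Definition expi (R : realType) (t : R) : R[i] := cos t +i* sin t.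

(* measurableTypeR R is R with its Borel sigma-algebra. *)
Definition charfun (R : realType) (m : probability (measurableTypeR R) R)
    (xi : R) : R[i] :=
  Cintegral m setT (fun x : R => expi (xi * x)).

Definition charfuns (R : realType) : set (R -> R[i]) :=
  [set phi | exists m : probability (measurableTypeR R) R, phi = charfun m].

(* 0 `^ 0 = 1 for powR, so the case p = 0 gives cos and sin. *)
Definition cosp (R : realType) (p theta : R) : R :=
  cos theta * `|cos theta| `^ p.

Definition sinp (R : realType) (p theta : R) : R :=
  sin theta * `|sin theta| `^ p.

Definition kac_solutions (R : realType) (p : R) : set (R -> R[i]) :=
  [set phi | forall xi : R,
    ((2 * pi)^-1)%:C *
      Cintegral (@lebesgue_measure R) `[0, 2 * pi]
        (fun theta : R => phi (xi * cosp p theta) * phi (xi * sinp p theta))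
    = phi xi].

Definition stable_form (R : realType) (alpha : R) : set (R -> R[i]) :=
  [set phi | exists2 a0 : R, 0 <= a0 &
    phi = fun xi : R => (expR (- (a0 * `|xi| `^ alpha)))%:C].

Arguments charfuns R : clear implicits.

(* Main.v *)
(* Averaging over the four quadrants shows that a solution is real, and
   [G r = phi (r ^ (1 + p))] satisfies [G r = M (G (r cos t) G (r sin t))], with [M] the
   mean over the first quadrant; the claim becomes [G r = exp (- a r ^ 2)].
   Put [h = 1 - G >= 0], so that [h = T h - M (h (r cos t) h (r sin t))] for the operator
   [T f r = 2 M (f (r cos t))], which fixes [r ^ 2].  To a function [f >= 0] one attaches
   [N r], the integral over [x >= r] of [(T f x - f x) / x ^ 3]; it is comparable to
   [r ^ -2 M (f (r cos t) sin t)].  A differential inequality for [N] shows that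
   [h = O(r ^ 2)] at [0].  Let [a] be the limit superior of [h r / r ^ 2] and
   [d = |G - exp (- a r ^ 2)|].  Then [d <= T d], so [N] for [d] is nonincreasing; on
   radii at which the limit superior is approached it tends to [0], hence [d = 0]. *)
Require Import Defs.
From mathcomp Require Import all_boot all_order all_algebra.
From mathcomp Require Import all_classical all_reals all_analysis.
From mathcomp Require Import measurable_realfun ring lra.
Import Order.TTheory GRing.Theory Num.Theory.
Import numFieldNormedType.Exports.
Local Open Scope classical_set_scope.
Local Open Scope ring_scope.
Set Implicit Arguments.
Unset Strict Implicit.
Unset Printing Implicit Defensive.

(** * Automation for continuity goals *)

Ltac cont1 :=
  match goal with
  | |- context [fmap ?F _] =>
    match F with
    | fun t => t => exact: cvg_id
    | fun _ => ?c => exact: cvg_cst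
    | fun t => (@?a t) - (@?b t) => apply: cvgB
    | fun t => (@?a t) + (@?b t) => apply: cvgD
    | fun t => - (@?a t) => apply: cvgN
    | fun t => (@?a t) * (@?b t) => apply: cvgM
    | fun t => `|@?a t| => apply: cvg_norm
    | fun t => (@?a t) ^+ ?n =>
        apply: (@continuous_comp _ _ _ a (fun u => u ^+ n)); [|exact: exprn_continuous]
    | fun t => cos t => exact: continuous_cos
    | fun t => sin t => exact: continuous_sin
    | fun t => expR t => exact: continuous_expR
    | fun t => ?f t => match goal with H : continuous f |- _ => exact: H end
    | fun t => ?f (@?a t) => apply: (@continuous_comp _ _ _ a f)
    | cst _ => exact: cvg_cst
    | ?f => match goal with H : continuous f |- _ => exact: H end
    | cos => exact: continuous_cos
    | sin => exact: continuous_sin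
    | expR => exact: continuous_expR
    end
  end.
Ltac cont := rewrite /continuous_at; repeat (rewrite /continuous_at /=; cont1).

(** * Integrals over the first quadrant *)

Section quadrant.
Variable R : realType.
Implicit Types (F G f g : R -> R).
Notation mu := (@lebesgue_measure R).

Definition quad F : R := (\int[mu]_(t in `[0, pi / 2]) F t)%R.

Lemma continuous_itv_integrable F (a b : R) :
  continuous F -> mu.-integrable `[a, b] (EFin \o F).
Proof.
move=> cF; apply: continuous_compact_integrable; first exact: segment_compact.
exact: continuous_subspaceT.
Qed.

Lemma quad_ext F G : (forall t, 0 <= t <= pi / 2 -> F t = G t) ->
  quad F = quad G.
Proof.
move=> FG; apply: eq_Rintegral => t; rewrite inE /= in_itv /= => tI.
exact: FG.
Qed.

Lemma quadZ (c : R) F : continuous F -> quad (fun t => c * F t) = c * quad F.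
Proof.
by move=> cF; rewrite /quad RintegralZl//; exact: continuous_itv_integrable.
Qed.

Lemma quadD F G : continuous F -> continuous G ->
  quad (fun t => F t + G t) = quad F + quad G.
Proof.
by move=> cF cG; rewrite /quad RintegralD//; exact: continuous_itv_integrable.
Qed.

Lemma quadB F G : continuous F -> continuous G ->
  quad (fun t => F t - G t) = quad F - quad G.
Proof.
by move=> cF cG; rewrite /quad RintegralB//; exact: continuous_itv_integrable.
Qed.

Lemma quad_le F G : continuous F -> continuous G ->
  (forall t, 0 <= t <= pi / 2 -> F t <= G t) -> quad F <= quad G.
Proof.
move=> cF cG FG; by apply: le_Rintegral => //; exact: continuous_itv_integrable.
Qed.

Lemma quad_ge0 F : (forall t, 0 <= t <= pi / 2 -> 0 <= F t) -> 0 <= quad F.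
Proof.
by move=> F0; apply: Rintegral_ge0 => t /=; rewrite in_itv /=; exact: F0.
Qed.

Lemma pihalf_gt0 : 0 < pi / 2 :> R.
Proof. by rewrite divr_gt0 ?pi_gt0. Qed.

Lemma integral_itv_FTC F f (a b : R) : a < b ->
  {within `[a, b], continuous F} -> continuous f ->
  (forall t, a < t < b -> is_derive t 1 F (f t)) ->
  (\int[mu]_(t in `[a, b]) f t)%R = F b - F a.
Proof.
move=> ab /(continuous_within_itvP _ ab)[_ Fa Fb] cf dF.
rewrite /Rintegral (@continuous_FTC2 _ _ F) //.
- exact: continuous_subspaceT.
- by split => // t; rewrite in_itv /= => tI; have [] := dF _ tI.
- move=> t; rewrite in_itv /= => tI; have ? := dF _ tI.
  by rewrite derive1E derive_val.
Qed.

Lemma continuous_antiderivative F (a : R) : continuous F ->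
  exists P, forall x, a < x -> is_derive x 1 P (F x).
Proof.
move=> cF; exists (fun x => \int[mu]_(t in `[a, x]) F t)%R => x ax.
have xx1 : x < x + 1 by rewrite ltrDl.
have iF : mu.-integrable `[a, x + 1] (EFin \o F) by exact: continuous_itv_integrable.
have [dPx <-] := continuous_FTC1_closed xx1 iF ax (cF x).
by split; [exact: dPx|rewrite derive1E].
Qed.

Lemma quad_FTC F f : continuous F -> continuous f ->
  (forall t, 0 < t < pi / 2 -> is_derive t 1 F (f t)) ->
  quad f = F (pi / 2) - F 0.
Proof.
move=> cF; apply: integral_itv_FTC; first exact: pihalf_gt0.
exact: continuous_subspaceT.
Qed.

Lemma integral_itv_antiderivative F f (a b : R) : a < b -> continuous f ->
  (forall t, a <= t <= b -> is_derive t 1 F (f t)) ->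
  (\int[mu]_(t in `[a, b]) f t)%R = F b - F a.
Proof.
move=> ab cf dF; apply: integral_itv_FTC => //.
- apply: derivable_within_continuous => x; rewrite in_itv /= => xI.
  by have [] := dF x xI.
- by move=> t /andP[/ltW at_ /ltW tb]; apply: dF; rewrite at_ tb.
Qed.

Lemma quad_eval F f (v : R) : continuous F -> continuous f ->
  (forall t, 0 < t < pi / 2 -> is_derive t 1 F (f t)) ->
  F (pi / 2) - F 0 = v -> quad f = v.
Proof. by move=> cF cf dF <-; exact: quad_FTC. Qed.

Lemma quad_reflect F : continuous F -> quad (fun t => F (pi / 2 - t)) = quad F.
Proof.
(* The base point -1 makes 0 an interior point, so that [P] has a two-sided derivative there as
   well. *)
move=> cF; have [P dP] := continuous_antiderivative (-1) cF.
have dP' (t : R) : 0 <= t -> is_derive t 1 P (F t).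
  by move=> t0; apply: dP; rewrite (lt_le_trans (ltrN10 R)).
have -> : quad F = P (pi / 2) - P 0.
  apply: integral_itv_antiderivative => // [|t /andP[+ _]]; last exact: dP'.
  exact: pihalf_gt0.
have -> : quad (fun t => F (pi / 2 - t)) = - P (pi / 2 - pi / 2) - - P (pi / 2 - 0).
  apply: (@integral_itv_antiderivative (fun t => - P (pi / 2 - t))) => [||t /andP[_ t1]].
  - exact: pihalf_gt0.
  - by move=> x; cont.
  have /dP' ? : 0 <= pi / 2 - t by rewrite subr_ge0.
  by apply: is_derive_eq; rewrite add0r mul1r mulrN1 opprK.
by rewrite subrr subr0 opprK addrC.
Qed.

Lemma integral_itv_shift F (a b s : R) : a < b -> continuous F ->
  (\int[mu]_(t in `[(a + s)%R, (b + s)%R]) F t)%R =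
  (\int[mu]_(t in `[a, b]) F (t + s)%R)%R.
Proof.
move=> ab cF; have [P dP] := continuous_antiderivative (a + s - 1) cF.
have {}dP (t : R) : a + s <= t -> is_derive t 1 P (F t).
  by move=> ast; apply: dP; rewrite (lt_le_trans _ ast) // ltrBlDr ltrDl.
transitivity (P (b + s) - P (a + s)); last symmetry.
  apply: integral_itv_antiderivative => // [|t /andP[+ _]]; last exact: dP.
  by rewrite ltrD2r.
apply: (@integral_itv_antiderivative (fun t => P (t + s))) => // [x|t /andP[t1 _]].
  by cont.
have /dP ? : a + s <= t + s by rewrite lerD2r.
by apply: is_derive_eq; rewrite addr0 mulr1.
Qed.

(** Folding the circle onto one quadrant puts the four sign patterns of cosine and sine under a
    single integral, where they can cancel or add up. *)
Lemma integral_four_quadrants F : continuous F ->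
  (\int[mu]_(t in `[0%R, (2 * pi)%R]) F t)%R =
  quad (fun t => F t + F (t + pi / 2) + F (t + pi) + F (t + (pi + pi / 2))).
Proof.
move=> cF; have p0 := pihalf_gt0.
have split_at (a b c : R) : a <= b -> b <= c ->
    (\int[mu]_(t in `[a, c]) F t)%R =
    (\int[mu]_(t in `[a, b]) F t)%R + (\int[mu]_(t in `[b, c]) F t)%R.
  move=> ab bc; rewrite -(@Rintegral_itv_obnd_cbnd _ b); last first.
    apply: integrableS (continuous_itv_integrable b c cF) => //.
    by apply: subset_itvr; rewrite bnd_simp.
  rewrite -(@Rintegral_itvB _ F (BLeft a) (BRight c) b) ?bnd_simp//.
    by rewrite addrC subrK.
  exact: continuous_itv_integrable.
have cFs s : continuous (fun t => F (t + s)) by move=> x; cont.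
rewrite quadD; [|by move=> x; cont|by []].
rewrite quadD; [|by move=> x; cont|by []].
rewrite quadD // /quad -!integral_itv_shift// !add0r.
have -> : pi / 2 + pi / 2 = pi :> R by lra.
have -> : pi / 2 + pi = pi + pi / 2 :> R by rewrite addrC.
have -> : pi / 2 + (pi + pi / 2) = 2 * pi :> R by lra.
have [le1 le2 le3 le4] : [/\ pi / 2 <= 2 * pi :> R, pi / 2 <= pi :> R,
    pi <= 2 * pi :> R & pi + pi / 2 <= 2 * pi :> R] by split; lra.
rewrite (split_at _ _ _ (ltW p0) le1) (split_at _ _ _ le2 le3).
by rewrite (split_at _ (pi + pi / 2) _ _ le4) ?lerDl ?(ltW p0)// !addrA.
Qed.
End quadrant.

(** * The excess functional *)

Section resolvent.
Variable R : realType.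
Implicit Types (f g E : R -> R) (a b x B : R).

Lemma is_derive_inv x : x != 0 -> is_derive x 1 (fun t : R => t^-1) (- x ^- 2).
Proof.
by move=> x0; split; [exact: derivableV|rewrite deriveV// derive_id scaler1].
Qed.

Lemma near0_norm_le (e : R) : 0 < e -> \forall u \near (0 : R), `|u| <= e.
Proof. exact: pseudometric_normed_Zmodule.nbhs0_le. Qed.

Lemma derive_ge0_le g (dg : R -> R) (a b : R) : a <= b ->
  (forall x, a <= x <= b -> is_derive x 1 g (dg x)) ->
  (forall x, a <= x <= b -> 0 <= dg x) -> g a <= g b.
Proof.
move=> ab dgP dg0; rewrite -subr_ge0.
have dg' x : x \in `]a, b[%R -> is_derive x 1 g (dg x).
  by rewrite in_itv /= => /andP[/ltW ax /ltW xb]; apply: dgP; rewrite ax xb.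
have cg : {within `[a, b], continuous g}.
  apply: derivable_within_continuous => x; rewrite in_itv /= => xI.
  by have [] := dgP x xI.
have [c cI ->] := MVT_segment ab dg' cg.
by rewrite mulr_ge0 ?subr_ge0// dg0//; move: cI; rewrite in_itv.
Qed.

Lemma derive_le0_ge g (dg : R -> R) (a b : R) : a <= b ->
  (forall x, a <= x <= b -> is_derive x 1 g (dg x)) ->
  (forall x, a <= x <= b -> dg x <= 0) -> g b <= g a.
Proof.
move=> ab dgP dg0; rewrite -lerN2.
apply: (@derive_ge0_le (fun x => - g x) (fun x => - dg x)) => // x xI.
  by have ? := dgP x xI; apply: is_derive_eq.
by rewrite oppr_ge0 dg0.
Qed.

(** Only [u = 0] needs an argument: there the factor [u] forces the limit 0, because [f (u^-1)]
    stays bounded. *)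
Lemma continuous_inv_scaled f B : continuous f -> (forall x, `|f x| <= B) ->
  continuous (fun u : R => f (u^-1) * u).
Proof.
move=> cf fB x; have [->|x0] := eqVneq x 0; last first.
  apply: cvgM; last exact: cvg_id.
  apply: (@continuous_comp _ _ _ (fun t : R => t^-1) f); last exact: cf.
  exact: inv_continuous.
rewrite /continuous_at mulr0; apply/cvgr0Pnorm_le => e e0.
have B0 : 0 <= B by apply: le_trans (fB 0).
near=> u; rewrite normrM.
apply: (@le_trans _ _ ((B + 1) * `|u|)).
  by rewrite ler_wpM2r // (le_trans (fB _)) // lerDl.
rewrite mulrC -ler_pdivlMr ?ltr_wpDl //.
by near: u; apply: near0_norm_le; rewrite divr_gt0 ?ltr_wpDl.
Unshelve. all: end_near. Qed.


(* [E x / x ^ 2] is the integral of [f y / y ^ 3] over [y >= x]; substituting [u = 1 / y]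
   moves the improper end to [u = 0], where the integrand [f (1 / u) u] is continuous
   also at [u = 0], since [f] is bounded. *)
Lemma resolvent_exists f B : continuous f -> (forall x, `|f x| <= B) -> f 0 = 0 ->
  exists E, [/\ continuous E, E 0 = 0 &
    forall x, 0 < x -> is_derive x 1 E ((2 * E x - f x) / x)].
Proof.
(* Starting at -1 instead of 0 adds a multiple of [x ^ 2] to [E]. This is harmless: [x ^ 2] solves
   the homogeneous equation and has excess 0. *)
move=> cf fB f0; have [P dP] :=
  continuous_antiderivative (-1) (continuous_inv_scaled cf fB).
have {}dP (y : R) : 0 < y -> is_derive y 1 P (f y^-1 * y).
  by move=> y0; apply: dP; rewrite (lt_trans _ y0) ?ltrN10.
(* The absolute value keeps the argument of [P] nonnegative, so that [E] is continuous on the whole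
   line. *)
pose E x := x ^+ 2 * P `|x|^-1; exists E.
have dE x : 0 < x -> is_derive x 1 E ((2 * E x - f x) / x).
  move=> x0; have xn0 : x != 0 by rewrite gt_eqF.
  apply: (@near_eq_is_derive _ _ _ (fun t : R => t ^+ 2 * P t^-1) E).
  - near=> t; rewrite /E gtr0_norm //; near: t; exact: lt_nbhsr.
  - have : 0 < x^-1 by rewrite invr_gt0.
    move=> /dP ?.
    have ? := is_derive_inv xn0.
    apply: is_derive_eq; rewrite /E gtr0_norm // invrK.
    by rewrite /GRing.scale /=; field.
split => //; last first.
  by rewrite /E expr2 !mul0r.
move=> x; have [->|x0] := eqVneq x 0; last first.
  apply: cvgM; first exact: exprn_continuous.
  apply: (@continuous_comp _ _ _ (fun t : R => `|t|^-1) P).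
    apply: (@continuous_comp _ _ _ (fun t : R => `|t|) (fun t : R => t^-1)).
      exact: norm_continuous.
    by apply: inv_continuous; rewrite normr_eq0.
  apply/differentiable_continuous/derivable1_diffP.
  by have [] := dP `|x|^-1; rewrite ?invr_gt0 ?normr_gt0.
rewrite /continuous_at {2}/E expr2 !mul0r; apply/cvgr0Pnorm_le => e e0.
have := cf 0; rewrite /continuous_at f0 => /cvgr0_norm_le /(_ _ e0).
move=> /nbhs_ballP[d /= d0 fd]; pose Y := 2 / d.
have Y0 : 0 < Y by rewrite divr_gt0.
have fY y : Y <= y -> `|f y^-1| <= e.
  move=> Yy; have y0 := lt_le_trans Y0 Yy; apply: fd.
  rewrite /ball /= sub0r normrN gtr0_norm ?invr_gt0// invf_plt ?posrE//.
  by rewrite (lt_le_trans _ Yy)// /Y ltr_pMl ?invr_gt0// ltr1n.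
(* For large [y] the derivative [f (1 / y) y] of [P] is at most [e y] in absolute value, so [P]
   grows at most like [e y ^ 2 / 2]; hence [x ^ 2 P (1 / |x|)] tends to 0 at 0. *)
have PY y : Y <= y -> `|P y| <= `|P Y| + e / 2 * y ^+ 2.
  move=> Yy; have y0 := lt_le_trans Y0 Yy.
  have up : P y - e / 2 * y ^+ 2 <= P Y - e / 2 * Y ^+ 2.
    apply: (@derive_le0_ge (fun y => P y - e / 2 * y ^+ 2)
      (fun y => f y^-1 * y - e * y)) => // z /andP[Yz _].
      have ? := dP z (lt_le_trans Y0 Yz).
      by apply: is_derive_eq; rewrite /GRing.scale /=; field.
    rewrite -mulrBl mulr_le0_ge0 ?subr_le0 ?(le_trans (ler_norm _) (fY _ Yz))//.
    exact: le_trans (ltW Y0) Yz.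
  have lo : P Y + e / 2 * Y ^+ 2 <= P y + e / 2 * y ^+ 2.
    apply: (@derive_ge0_le (fun y => P y + e / 2 * y ^+ 2)
      (fun y => f y^-1 * y + e * y)) => // z /andP[Yz _].
      have ? := dP z (lt_le_trans Y0 Yz).
      by apply: is_derive_eq; rewrite /GRing.scale /=; field.
    rewrite -mulrDl mulr_ge0 ?(le_trans (ltW Y0) Yz)//.
    by have := fY _ Yz; rewrite ler_norml => /andP[]; rewrite -subr_ge0 opprK addrC.
  have eY : 0 <= e / 2 * Y ^+ 2 by rewrite mulr_ge0 ?sqr_ge0 ?divr_ge0 ?ltW.
  have := ler_norm (P Y); have := ler_norm (- P Y); rewrite normrN => PYN PYp.
  by apply/ler_normlP; split; lra.
near=> u.
have [->|u0] := eqVneq u 0; first by rewrite /E expr2 !mul0r normr0 ltW.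
have un : 0 < `|u| by rewrite normr_gt0.
rewrite /E normrM normrX; apply: (@le_trans _ _ (`|u| ^+ 2 * (`|P Y| + e / 2 * `|u|^-1 ^+ 2))).
  rewrite ler_wpM2l ?sqr_ge0 ?PY // /Y -(invf_div d 2) lef_pV2 ?posrE ?divr_gt0//.
  near: u; apply: near0_norm_le; by rewrite divr_gt0.
rewrite mulrDr mulrCA -exprMn divff ?gt_eqF// expr1n mulr1.
rewrite -lerBrDr.
have -> : e - e / 2 = e / 2 by field.
apply: (@le_trans _ _ (`|u| * (`|P Y| + 1))).
  have u1 : `|u| <= 1 by near: u; exact: near0_norm_le.
  by apply: ler_pM; rewrite ?sqr_ge0 ?lerDl// expr2 ler_piMr.
rewrite -ler_pdivlMr ?ltr_wpDl //; near: u; apply: near0_norm_le.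
by rewrite divr_gt0 ?divr_gt0 ?ltr_wpDl.
Unshelve. all: end_near. Qed.
End resolvent.

(** * Comparison of the excess with the sine-weighted mean *)

Section radial.
Variable R : realType.
Implicit Types (f g E : R -> R) (r x t : R).
Notation mu := (@lebesgue_measure R).

(** Not normalized: constants are multiplied by [pi / 2] and [x ^ 2] by [pi / 4], the source of
    these factors below. *)
Definition mean_cos f r := quad (fun t => f (r * cos t)).
Definition mean_cos_sin f r := quad (fun t => f (r * cos t) * sin t).
(** This is the equation [(E x / x ^ 2)' = - f x / x ^ 3], solved for the derivative of [E]. *)
Definition solves_resolvent f E :=
  forall x, 0 < x -> is_derive x 1 E ((2 * E x - f x) / x).
(* Up to normalization, [excess E r / r ^ 2] is the integral over [x >= r] of
   [x ^ -3] times the defect [Tf x - f x] of [f] for the operator [T] sending [f] to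
   twice the mean of [f (x cos t)]. *)
Definition excess E r := mean_cos E r - pi / 4 * E r.

Lemma cos_quad_ge0 t : 0 <= t <= pi / 2 -> 0 <= cos t.
Proof.
move=> /andP[t0 t1]; apply: cos_ge0_pihalf; rewrite t1 andbT.
by rewrite (le_trans _ t0) // oppr_le0 ltW ?pihalf_gt0.
Qed.

Lemma cos_quad_gt0 t : 0 <= t < pi / 2 -> 0 < cos t.
Proof.
move=> /andP[t0 t1]; apply: cos_gt0_pihalf; rewrite t1 andbT.
by rewrite (lt_le_trans _ t0) // oppr_lt0 pihalf_gt0.
Qed.

Lemma sin_quad_ge0 t : 0 <= t <= pi / 2 -> 0 <= sin t.
Proof.
move=> /andP[t0 t1]; apply: sin_ge0_pi; rewrite t0 (le_trans t1) //.
by have := pi_gt0 R; lra.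
Qed.

Lemma quad_cos2 : quad (fun t : R => cos t ^+ 2) = pi / 4.
Proof.
apply: (@quad_eval _ (fun t => (t + sin t * cos t) / 2)).
- by move=> t; cont.
- by move=> t; cont.
- move=> t _; apply: is_derive_eq; rewrite /GRing.scale /=.
  by have cs := cos2Dsin2 t; lra.
- by rewrite sin_pihalf cos_pihalf sin0; field.
Qed.

Lemma quad_sin : quad (fun t : R => sin t) = 1.
Proof.
apply: (@quad_eval _ (fun t => - cos t)).
- by move=> t; cont.
- by move=> t; cont.
- by move=> t _; apply: is_derive_eq; rewrite opprK.
- by rewrite cos_pihalf cos0; field.
Qed.

Lemma quad_cst (c : R) : quad (fun=> c) = c * (pi / 2).
Proof.
apply: (@quad_eval _ (fun t => c * t)).
- by move=> t; cont.
- by move=> t; cont.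
- by move=> t _; apply: is_derive_eq; rewrite /GRing.scale /=; ring.
- by ring.
Qed.

Section ratio.
Variables (f E : R -> R).
Hypotheses (cf : continuous f) (cE : continuous E) (E0 : E 0 = 0).
Hypothesis dE : solves_resolvent f E.

(** The deviation of [E] from quadratic homogeneity; its integral over the quadrant is the
    excess. *)
Let D r t := E (r * cos t) - cos t ^+ 2 * E r.

Let cD r : continuous (D r).
Proof. by move=> t; rewrite /D; cont. Qed.

Lemma excessE r : excess E r = quad (D r).
Proof.
rewrite quadB; [|by move=> t; cont..].
rewrite [X in _ - X](_ : _ = E r * quad (fun t => cos t ^+ 2)); last first.
  rewrite -quadZ; last by move=> t; cont.
  by apply: quad_ext => t _; rewrite mulrC.
by rewrite quad_cos2 mulrC.
Qed.

(** The factor [cos t] cancels the denominator of the resolvent equation at [r cos t]; the terms in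
    [E] then recombine to a multiple of [D]. *)
Let derD r t : 0 < r -> 0 < t < pi / 2 -> is_derive t 1 (fun t => cos t * D r t)
  (sin t * f (r * cos t) - 3 * (sin t * D r t)).
Proof.
move=> r0 /andP[t0 t1]; have c0 : 0 < cos t by rewrite cos_quad_gt0 // ltW.
have dEc := dE (mulr_gt0 r0 c0).
rewrite /D; apply: is_derive_eq; rewrite /GRing.scale /=.
by field; rewrite !gt_eqF.
Qed.

Hypothesis f0 : forall x, 0 <= x -> 0 <= f x.

Lemma resolvent_ratio x y : 0 < x -> x <= y -> E y * y^-1 ^+ 2 <= E x * x^-1 ^+ 2.
Proof.
move=> x0 xy; apply: (@derive_le0_ge R (fun x => E x * x^-1 ^+ 2)
  (fun x => - (f x * x^-1 ^+ 3))) => // z /andP[xz _].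
  have z0 := lt_le_trans x0 xz; have zn0 : z != 0 by rewrite gt_eqF.
  have ? := dE z0; have ? := is_derive_inv zn0.
  by apply: is_derive_eq; rewrite /GRing.scale /=; field.
have z0 := lt_le_trans x0 xz.
by rewrite oppr_le0 mulr_ge0 ?f0 ?exprn_ge0 ?invr_ge0 // ltW.
Qed.

(** Monotonicity of [E x / x ^ 2], applied between [r cos t] and [r]; where the cosine vanishes,
    [E 0 = 0] takes over. *)
Let D_ge0 r t : 0 < r -> 0 <= t <= pi / 2 -> 0 <= D r t.
Proof.
move=> r0 tI; have := cos_quad_ge0 tI; rewrite le0r => /orP[/eqP c0|c0].
  by rewrite /D c0 mulr0 E0 expr0n mul0r subrr.
have /(resolvent_ratio (mulr_gt0 r0 c0)) : r * cos t <= r.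
  by rewrite ler_piMr ?cos_le1 // ltW.
rewrite -(ler_pM2r (exprn_gt0 2 (mulr_gt0 r0 c0))) -subr_ge0 => h.
rewrite (_ : D r t = E (r * cos t) * (r * cos t)^-1 ^+ 2 * (r * cos t) ^+ 2 -
   E r * r^-1 ^+ 2 * (r * cos t) ^+ 2) //.
by rewrite /D; field; rewrite !gt_eqF.
Qed.

(* [D r] vanishes at the ends of [[0, pi/2]] once multiplied by [cos], so the integral
   of the derivative of [cos * D r] is zero. *)
Lemma excess_lower r : 0 < r -> mean_cos_sin f r <= 3 * excess E r.
Proof.
move=> r0; have cDr : continuous (D r) by exact: cD.
have csD : continuous (fun t => sin t * D r t).
  by move=> t; cont.
have : quad (fun t => sin t * f (r * cos t) - 3 * (sin t * D r t)) = 0.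
  apply: (@quad_eval _ (fun t => cos t * D r t)).
  - by move=> t; cont.
  - by move=> t; cont.
  - by move=> t; exact: derD.
  - by rewrite /D cos_pihalf cos0 mulr1 expr1n mul1r mul0r !mul1r subrr subr0.
rewrite quadB; [|by move=> t; cont..].
rewrite quadZ // => /eqP; rewrite subr_eq0 => /eqP e.
rewrite (_ : mean_cos_sin f r = quad (fun t => sin t * f (r * cos t))); last first.
  by apply: quad_ext => t _; rewrite mulrC.
rewrite e ler_pM2l // excessE; apply: quad_le => // t tI.
by rewrite ler_piMl ?D_ge0 ?sin_le1.
Qed.

(* The weight [4/3 - sin] makes [- d/dt ((4/3 - sin) cos D)] at least
   [D - 4/3 f sin], because [cos ^ 2 + 4 sin - 3 sin ^ 2 >= 1]. *)
Lemma excess_upper r : 0 < r -> excess E r <= 4 / 3 * mean_cos_sin f r.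
Proof.
move=> r0; have cDr : continuous (D r) by exact: cD.
pose F' t := (4 / 3 - sin t) * (sin t * f (r * cos t) - 3 * (sin t * D r t))
  - cos t * (cos t * D r t).
have cF' : continuous F' by move=> t; rewrite /F'; cont.
have dF t : 0 < t < pi / 2 ->
    is_derive t 1 (fun t => (4 / 3 - sin t) * (cos t * D r t)) (F' t).
  move=> tI; have ? := derD r0 tI; apply: is_derive_eq.
  by rewrite /F' /GRing.scale /=; ring.
have cF : continuous (fun t => (4 / 3 - sin t) * (cos t * D r t)).
  by move=> t; cont.
have F'0 : quad F' = 0.
  rewrite (quad_FTC cF cF' dF) /D cos_pihalf cos0 sin0 mulr1 expr1n; ring.
(* Subtracting [quad F' = 0] on the right reduces the claim to integrands, whose difference is
   [4 s (1 - s) D + s ^ 2 f] with [s = sin t]. *)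
rewrite excessE /mean_cos_sin -[leRHS]subr0 -[in leRHS]F'0.
rewrite -quadZ; last by move=> t; cont.
rewrite -quadB //; last by move=> t; cont.
apply: quad_le => // [t|t tI]; first by cont.
have s0 := sin_quad_ge0 tI; have s1 := sin_le1 t; have Dt := D_ge0 r0 tI.
have ft : 0 <= f (r * cos t).
  by apply/f0/mulr_ge0; [exact: ltW|exact: cos_quad_ge0].
have c2 : cos t ^+ 2 = 1 - sin t ^+ 2 by rewrite cos2sin2.
rewrite -subr_ge0 /F'.
rewrite (_ : _ - _ - _ = 4 * (D r t * (sin t * (1 - sin t))) + sin t ^+ 2 * f (r * cos t)).
  rewrite addr_ge0 //; last exact: mulr_ge0 (sqr_ge0 _) ft.
  by do ![apply: mulr_ge0 => //]; rewrite subr_ge0.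
rewrite (_ : cos t * (cos t * D r t) = (1 - sin t ^+ 2) * D r t); first by field.
by rewrite -c2; ring.
Qed.
End ratio.
End radial.

(** * Differentiation of the excess in the radius *)

Section radial_derive.
Variable R : realType.
Implicit Types (f g E : R -> R) (r x t : R).
Notation mu := (@lebesgue_measure R).

Lemma continuous_bounded_itv g (a b : R) : a <= b -> continuous g ->
  exists K, forall x, a <= x <= b -> `|g x| <= K.
Proof.
move=> ab cg; have [|c cI cmax] := @EVT_max R (fun x => `|g x|) a b ab.
  by apply: continuous_subspaceT => x; cont.
by exists `|g c| => x xI; apply: cmax; rewrite in_itv.
Qed.

(** Differentiation under the integral. The chain rule factor [cos t] cancels the one in the
    denominator [x cos t], so on []r / 2, 2 r[] the derivative is dominated by the constant
    [K / (r / 2)]; at [t = pi / 2] the integrand is constant in [x], since [E 0 = 0]. *)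
Lemma mean_cos_derive f E r : continuous f -> continuous E -> f 0 = 0 -> E 0 = 0 ->
  solves_resolvent f E -> 0 < r ->
  is_derive r 1 (mean_cos E) ((2 * mean_cos E r - mean_cos f r) / r).
Proof.
move=> cf cE f0 E0 dE r0; have r20 : 0 < r / 2 by rewrite divr_gt0.
have rr2 : r / 2 < r by rewrite ltr_pdivrMr // ltr_pMr // ltr1n.
have cg : continuous (fun x => 2 * E x - f x) by move=> x; cont.
have [K gK] : exists K, forall x, 0 <= x <= 2 * r -> `|2 * E x - f x| <= K.
  by apply: continuous_bounded_itv => //; rewrite mulr_ge0 ?ltW.
have du x t : 0 < x -> 0 <= t <= pi / 2 ->
    is_derive x 1 (fun x => E (x * cos t)) ((2 * E (x * cos t) - f (x * cos t)) / x).
  move=> x0 tI; have := cos_quad_ge0 tI; rewrite le0r => /orP[/eqP ->|c0].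
    rewrite mulr0 E0 f0 mulr0 subr0 mul0r.
    rewrite (_ : (fun _ => _) = cst 0) //; first exact: is_derive_cst.
    by apply/funext => z; rewrite mulr0 E0.
  have ? := dE _ (mulr_gt0 x0 c0); apply: is_derive_eq.
  by rewrite /GRing.scale /=; field; rewrite !gt_eqF.
pose I : set R := `]r / 2, 2 * r[%classic.
have Ir : I r by rewrite /I /= in_itv /= rr2 ltr_pMl // ltr1n.
have I0 x : I x -> 0 < x <= 2 * r.
  rewrite /I /= in_itv /= => /andP[x1 x2].
  by rewrite (lt_trans r20) // ltW.
have iE x : I x -> mu.-integrable `[0, pi / 2] (EFin \o (fun t => E (x * cos t))).
  by move=> _; apply: continuous_itv_integrable => t; cont.
have d1 x t : I x -> `[0, pi / 2]%classic t -> derivable (fun x => E (x * cos t)) x 1.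
  by move=> /I0/andP[x0 _]; rewrite /= in_itv /= => tI; have [] := du _ _ x0 tI.
have iG : mu.-integrable `[0, pi / 2] (EFin \o cst (K / (r / 2))).
  by apply: continuous_itv_integrable => t; cont.
have G0 t : 0 <= cst (K / (r / 2)) t.
  rewrite divr_ge0 ?(ltW r20)//; apply: le_trans (gK 0 _) => //.
  by rewrite lexx mulr_ge0 // ltW.
have Gub x t : I x -> `[0, pi / 2]%classic t ->
    `|partial1of2 (fun x t => E (x * cos t)) x t| <= cst (K / (r / 2)) t.
  move=> Ix; have /andP[x0 x2] := I0 _ Ix; rewrite /= in_itv /= => tI.
  have ? := du _ _ x0 tI; rewrite partial1of2E derive_val normrM normfV.
  rewrite [`|x|]gtr0_norm // ler_pM ?invr_ge0 ?(ltW x0)//.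
    apply: gK; have c0 := cos_quad_ge0 tI; rewrite mulr_ge0 ?(ltW x0)//=.
    by rewrite (le_trans _ x2)// ler_piMr ?cos_le1 ?ltW.
  by rewrite lef_pV2 ?posrE //; move: Ix; rewrite /I /= in_itv /= => /andP[/ltW].
have m02 : measurable (`[0, pi / 2]%classic : set (measurableTypeR R)) by [].
split.
  exact: (@derivable_under_integral _ _ _ mu _ _ m02 _ _ _ Ir iE d1 _ G0 iG Gub).
rewrite -derive1E (@differentiation_under_integral _ _ _ mu _ _ m02 _ _ _ Ir iE d1 _ G0 iG Gub).
transitivity (quad (fun t => r^-1 * (2 * E (r * cos t) - f (r * cos t)))).
  apply: quad_ext => t tI; have ? := du _ _ r0 tI.
  by rewrite partial1of2E derive_val mulrC.
rewrite quadZ; last by move=> t; cont.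
rewrite quadB; [|by move=> t; cont..].
rewrite quadZ; last by move=> t; cont.
by rewrite mulrC.
Qed.

(** Dilation means preserve the resolvent equation, so the excess solves it too, with source
    [mean_cos f - pi / 4 f], the defect of [f]. *)
Lemma excess_derive f E r : continuous f -> continuous E -> f 0 = 0 -> E 0 = 0 ->
  solves_resolvent f E -> 0 < r ->
  is_derive r 1 (excess E) ((2 * excess E r - mean_cos f r + pi / 4 * f r) / r).
Proof.
move=> cf cE f0 E0 dE r0; have ? := mean_cos_derive cf cE f0 E0 dE r0.
have ? := dE r r0; rewrite /excess; apply: is_derive_eq.
by rewrite /GRing.scale /=; field; rewrite gt_eqF.
Qed.
End radial_derive.

(** * Subsolutions of the linearized equation *)

Section subsolutions.
Variable R : realType.
Implicit Types (f g E : R -> R) (r x t : R).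

Lemma quad_sqr_1Bsin : quad (fun t : R => (1 - sin t) ^+ 2) = 3 / 4 * pi - 2.
Proof.
transitivity (quad (fun t : R => 2 - 2 * sin t - cos t ^+ 2)).
  by apply: quad_ext => t _; rewrite cos2sin2; ring.
rewrite quadB; [|by move=> t; cont..].
rewrite quadB; [|by move=> t; cont..].
rewrite quadZ; last by move=> t; cont.
by rewrite quad_cst quad_sin quad_cos2; field.
Qed.

Lemma pi_lt4 : pi < 4 :> R.
Proof. by have := pihalf_lt2 R; lra. Qed.

(* [1 <= 2 s + (1 - s)^2], and the mean of [2 (1 - s)^2] is [3 - 8 / pi < 1], so a
   maximum of a subsolution is controlled by its sine-weighted mean. *)
Lemma subsolution_le f (k rho : R) : continuous f -> (forall x, 0 <= f x) -> f 0 = 0 ->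
  0 <= k ->
  (forall r, 0 < r <= rho -> pi / 4 * f r <= mean_cos f r) ->
  (forall r, 0 < r <= rho -> mean_cos_sin f r <= k) ->
  forall r, 0 <= r <= rho -> f r <= k / (1 - pi / 4).
Proof.
move=> cf f_ge0 f0 k0 subf fk r /andP[r0 rrho].
have p4 := pi_lt4; have c0 : 0 < 1 - pi / 4 :> R by lra.
have [|m + fm] := @EVT_max R f 0 rho (le_trans r0 rrho).
  exact: continuous_subspaceT.
rewrite in_itv /= => /andP[m0 mrho].
apply: (@le_trans _ _ (f m)); first by apply: fm; rewrite in_itv /= r0.
move: m0; rewrite le_eqVlt => /predU1P[<-|m0].
  by rewrite f0 divr_ge0 // ltW.
rewrite ler_pdivlMr //.
have := subf m; rewrite m0 => /(_ mrho) sm.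
have : mean_cos f m <= 2 * mean_cos_sin f m + f m * (3 / 4 * pi - 2).
  rewrite -quad_sqr_1Bsin -!quadZ; [|by move=> t; cont..].
  rewrite -quadD; [|by move=> t; cont..].
  apply: quad_le => [t|t|t tI]; [by cont..|].
  have c_ge0 := cos_quad_ge0 tI.
  have : f (m * cos t) <= f m.
    apply: fm; rewrite in_itv /= mulr_ge0 ?(ltW m0)//=.
    by rewrite (le_trans _ mrho)// ler_piMr ?cos_le1 ?ltW.
  move: (f_ge0 (m * cos t)) (sqr_ge0 (1 - sin t)) (sqr_ge0 (sin t)); nra.
(* Together with the subsolution inequality at the maximum [m] this gives
   [(2 - pi / 2) f m <= 2 k]. *)
have := fk m; rewrite m0 => /(_ mrho); lra.
Qed.

Lemma mean_cos_sin_ge0 f r : (forall x, 0 <= f x) -> 0 <= mean_cos_sin f r.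
Proof. by move=> f0; apply: quad_ge0 => t tI; rewrite mulr_ge0 ?sin_quad_ge0. Qed.

Lemma mean_cos_sin_le f r : continuous f -> (forall x, 0 <= f x) ->
  mean_cos_sin f r <= mean_cos f r.
Proof.
move=> cf f0; apply: quad_le => [t|t|t tI]; [by cont..|].
by rewrite ler_piMr ?sin_le1.
Qed.

(* [excess E r / r^2] is nonincreasing and tends to [0] along a sequence of radii. *)
Lemma subsolution_eq0 f (B : R) : continuous f -> (forall x, 0 <= f x <= B) -> f 0 = 0 ->
  (forall r, 0 < r -> pi / 4 * f r <= mean_cos f r) ->
  (forall e d : R, 0 < e -> 0 < d ->
     exists2 r, 0 < r < d & mean_cos f r <= e * r ^+ 2) ->
  forall r, 0 <= r -> f r = 0.
Proof.
move=> cf fB f0 subf small r r0.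
have f_ge0 x : 0 <= f x by have /andP[] := fB x.
have [|//|E [cE E0 dE]] := @resolvent_exists R f B cf.
  by move=> x; rewrite ger0_norm //; have /andP[] := fB x.
have dn := excess_derive cf cE f0 E0 dE.
have mono x y : 0 < x -> x <= y -> excess E y * y^-1 ^+ 2 <= excess E x * x^-1 ^+ 2.
  move=> x0 xy; apply: (@derive_le0_ge R (fun x => excess E x * x^-1 ^+ 2)
    (fun x => (pi / 4 * f x - mean_cos f x) * x^-1 ^+ 3)) => // z /andP[xz _].
    have z0 := lt_le_trans x0 xz; have zn0 : z != 0 by rewrite gt_eqF.
    have ? := dn z z0; have ? := is_derive_inv zn0.
    by apply: is_derive_eq; rewrite /GRing.scale /=; field.
  have z0 := lt_le_trans x0 xz.
  by rewrite mulr_le0_ge0 ?subr_le0 ?subf// exprn_ge0 // invr_ge0 ltW.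
have n_le0 y : 0 < y -> excess E y <= 0.
  move=> y0; rewrite -(pmulr_lle0 _ (exprn_gt0 2 (_ : 0 < y^-1))) ?invr_gt0//.
  apply/ler_addgt0Pr => e e0; rewrite add0r.
  (* The factor [3 / 4] compensates the [4 / 3] of [excess_upper]. *)
  have e340 : 0 < e * (3 / 4) by rewrite mulr_gt0 // divr_gt0.
  have [x /andP[x0 xy] xe] := small (e * (3 / 4)) y e340 y0.
  apply: (le_trans (mono _ _ x0 (ltW xy))).
  rewrite exprVn ler_pdivrMr ?exprn_gt0 //.
  have := excess_upper cf cE E0 dE (fun x _ => f_ge0 x) x0.
  have := mean_cos_sin_le x cf f_ge0; lra.
(* A nonpositive excess forces [mean_cos_sin f <= 0], so the maximum estimate applies with
   [k = 0]. *)
apply/eqP; rewrite eq_le f_ge0 andbT -(mul0r (1 - pi / 4)^-1).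
apply: (@subsolution_le f 0 r) => // [x /andP[x0 _]|x /andP[x0 _]|].
- exact: subf.
- have := excess_lower cf cE E0 dE (fun x _ => f_ge0 x) x0.
  by have := n_le0 x x0; lra.
- by rewrite r0 lexx.
Qed.
End subsolutions.

(** * Quadratic bound at the origin for the nonlinear equation *)

Section quadratic_bound.
Variable R : realType.
Implicit Types (f g h E : R -> R) (r x t : R).

(** For [G] this is the circular mean in the equation; for [h = 1 - G] it is the quadratic remainder
    after linearization. *)
Definition cross h r := quad (fun t => h (r * cos t) * h (r * sin t)).

Lemma cos_pihalfB t : cos (pi / 2 - t) = sin t.
Proof. by rewrite -opprB cosN cosBpihalf. Qed.

Lemma sin_pihalfB t : sin (pi / 2 - t) = cos t.
Proof. by rewrite -opprB sinN sinBpihalf opprK. Qed.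

Lemma quad_cos_sin f r : continuous f -> quad (fun t => f (r * sin t)) = mean_cos f r.
Proof.
move=> cf; rewrite -[RHS]quad_reflect; last by move=> t; cont.
by apply: quad_ext => t _; rewrite cos_pihalfB.
Qed.

(** Since [cos t + sin t >= 1] on the quadrant, this weight may be inserted; its two halves agree by
    the reflection [t -> pi / 2 - t], and in the sine half the factor [h (r sin t)] is bounded by
    [H]. *)
Lemma cross_le h (H r : R) : continuous h -> (forall x, 0 <= h x) -> 0 <= r ->
  (forall x, 0 <= x <= r -> h x <= H) -> cross h r <= 2 * H * mean_cos_sin h r.
Proof.
move=> ch h0 r0 hH.
have cG : continuous (fun t => h (r * cos t) * h (r * sin t) * sin t).
  by move=> t; cont.
have cG' : continuous (fun t => h (r * cos t) * h (r * sin t) * cos t).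
  by move=> t; cont.
have symG : quad (fun t => h (r * cos t) * h (r * sin t) * cos t) =
    quad (fun t => h (r * cos t) * h (r * sin t) * sin t).
  rewrite -(quad_reflect cG'); apply: quad_ext => t _.
  by rewrite cos_pihalfB sin_pihalfB [h _ * h _]mulrC.
apply: (@le_trans _ _ (2 * quad (fun t => h (r * cos t) * h (r * sin t) * sin t))).
  rewrite mulr_natl mulr2n -[X in X + _]symG -quadD //.
  apply: quad_le => [t|t|t tI]; [by cont..|].
  rewrite -mulrDr ler_peMr ?mulr_ge0 //.
  have c0 := cos_quad_ge0 tI; have s0 := sin_quad_ge0 tI.
  have := cos2Dsin2 t; have := cos_le1 t; have := sin_le1 t; nra.
rewrite -mulrA ler_pM2l // -quadZ; last by move=> t; cont.
apply: quad_le => [t|t|t tI]; [by cont..|].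
have c0 := cos_quad_ge0 tI; have s0 := sin_quad_ge0 tI.
rewrite -mulrA mulrCA ler_wpM2r ?mulr_ge0 //.
by apply: hH; rewrite mulr_ge0 //= ler_piMr ?sin_le1.
Qed.

(* Since [cross h = o(mean_cos_sin h)], the excess [n] satisfies [r n' >= (2 - o(1)) n]:
   first [n / r] is nondecreasing near [0], so that [h r = O(r)]; fed back into the
   estimate of [cross h], this makes [n / r ^ 2 * exp (3 K r)] nondecreasing. *)
Lemma quadratic_bound h (B : R) : continuous h -> (forall x, 0 <= h x <= B) -> h 0 = 0 ->
  (forall r, 0 < r -> pi / 4 * h r = mean_cos h r - cross h r / 2) ->
  exists K rho : R, 0 < rho /\ forall r, 0 <= r <= rho -> h r <= K * r ^+ 2.
Proof.
move=> ch hB h0 eqh.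
have h_ge0 x : 0 <= h x by have /andP[] := hB x.
have p4 := pi_lt4 R; pose C : R := (1 - pi / 4)^-1.
have C0 : 0 < C by rewrite invr_gt0; lra.
have [|//|E [cE E0 dE]] := @resolvent_exists R h B ch.
  by move=> x; rewrite ger0_norm //; have /andP[] := hB x.
have dn := excess_derive ch cE h0 E0 dE.
have lown r : 0 < r -> mean_cos_sin h r <= 3 * excess E r.
  exact: (excess_lower ch cE E0 dE (fun x _ => h_ge0 x)).
have n_ge0 r : 0 < r -> 0 <= excess E r.
  by move=> r0; have := lown r r0; have := mean_cos_sin_ge0 r h_ge0; lra.
have subh r : 0 < r -> pi / 4 * h r <= mean_cos h r.
  move=> r0; rewrite eqh // lerBlDr lerDl divr_ge0 //.
  by apply: quad_ge0 => t _; rewrite mulr_ge0.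
(* The defect [mean_cos h - pi / 4 h] equals [cross h / 2], which is at most [H mean_cos_sin h],
   hence at most [3 H] times the excess. *)
have dn_ge (r H : R) : 0 < r -> (forall x, 0 <= x <= r -> h x <= H) ->
    2 * excess E r - 3 * H * excess E r <=
      2 * excess E r - mean_cos h r + pi / 4 * h r.
  move=> r0 hH; rewrite eqh //.
  have H0 : 0 <= H by apply: le_trans (h_ge0 0) (hH _ _); rewrite lexx ltW.
  have := cross_le ch h_ge0 (ltW r0) hH.
  have := ler_wpM2l H0 (lown r r0); lra.
have hC (k r : R) : 0 < r -> 0 <= k ->
    (forall x, 0 < x <= r -> mean_cos_sin h x <= k) -> h r <= k * C.
  move=> r0 k0 hk; apply: (@subsolution_le R h k r) => //.
    by move=> x /andP[x0 _]; exact: subh.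
  by rewrite lexx ltW.
(* With [H = 1 / 3] the factor [2 - 3 H] is 1, just enough to make [excess E r / r]
   nondecreasing. *)
have [rho rho0 hrho] : exists2 rho : R, 0 < rho & forall r, 0 <= r <= rho -> h r <= 3^-1.
  have i3 : 0 < 3^-1 :> R by rewrite invr_gt0.
  have := ch 0; rewrite /continuous_at h0 => /cvgr0_norm_le /(_ _ i3).
  move=> /nbhs_ballP[d /= d0 hd].
  exists (d / 2) => [|r /andP[r0 rd]]; first by rewrite divr_gt0.
  apply: le_trans (ler_norm _) (hd _ _); rewrite /ball /= sub0r normrN ger0_norm //.
  by rewrite (le_lt_trans rd) // ltr_pdivrMr // ltr_pMr // ltr1n.
pose K1 := excess E rho / rho.
have K1_ge0 : 0 <= K1 by rewrite divr_ge0 ?n_ge0 // ltW.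
have nK1 r : 0 < r <= rho -> excess E r <= K1 * r.
  move=> /andP[r0 rrho]; rewrite -ler_pdivrMr //.
  apply: (@derive_ge0_le R (fun r => excess E r / r)
    (fun r => (2 * excess E r - mean_cos h r + pi / 4 * h r - excess E r) * r^-1 ^+ 2)) => // z.
    move=> /andP[rz _]; have z0 := lt_le_trans r0 rz; have zn0 : z != 0 by rewrite gt_eqF.
    have ? := dn z z0; have ? := is_derive_inv zn0.
    by apply: is_derive_eq; rewrite /GRing.scale /=; field.
  move=> /andP[rz zrho]; have z0 := lt_le_trans r0 rz.
  rewrite mulr_ge0 ?sqr_ge0 // subr_ge0.
  apply: le_trans (dn_ge z 3^-1 z0 _); first by lra.
  by move=> x /andP[x0 xz]; apply: hrho; rewrite x0 (le_trans xz).
(* On []0, r]] the sine-weighted mean is at most three times the excess, hence at most [3 K1 r];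
   [hC] turns this into a bound on [h r]. *)
pose K2 := 3 * K1 * C.
have K2_ge0 : 0 <= K2 by apply: mulr_ge0 (ltW C0); exact: mulr_ge0.
have hK2 r : 0 <= r <= rho -> h r <= K2 * r.
  rewrite le_eqVlt => /andP[/predU1P[<-|r0] rrho]; first by rewrite h0 mulr0.
  rewrite /K2 mulrAC; apply: hC => //; first by do ![apply: mulr_ge0 => //]; exact: ltW.
  move=> x /andP[x0 xr]; apply: (le_trans (lown x x0)).
  rewrite -mulrA ler_pM2l //; apply: (@le_trans _ _ (K1 * x)).
    by apply: nK1; rewrite x0 (le_trans xr).
  by rewrite ler_wpM2l.
(* The integrating factor [expR (3 K2 r)] absorbs the loss [3 H] of [dn_ge], where now
   [H = K2 r]. *)
pose K3 := excess E rho * rho^-1 ^+ 2 * expR (3 * K2 * rho).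
have nK3 r : 0 < r <= rho -> excess E r <= K3 * r ^+ 2.
  move=> /andP[r0 rrho]; rewrite -ler_pdivrMr ?exprn_gt0 // -exprVn.
  apply: (@le_trans _ _ (excess E r * r^-1 ^+ 2 * expR (3 * K2 * r))).
    apply: ler_peMr; first exact: mulr_ge0 (n_ge0 _ r0) (sqr_ge0 _).
    by rewrite -expR0 ler_expR; apply: mulr_ge0 (ltW r0); exact: mulr_ge0.
  apply: (@derive_ge0_le R (fun r => excess E r * r^-1 ^+ 2 * expR (3 * K2 * r))
    (fun r => (2 * excess E r - mean_cos h r + pi / 4 * h r -
       (2 * excess E r - 3 * (K2 * r) * excess E r)) * r^-1 ^+ 3 * expR (3 * K2 * r))) => // z.
    move=> /andP[rz _]; have z0 := lt_le_trans r0 rz; have zn0 : z != 0 by rewrite gt_eqF.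
    have ? := dn z z0; have ? := is_derive_inv zn0.
    by apply: is_derive_eq; rewrite /GRing.scale /=; field.
  move=> /andP[rz zrho]; have z0 := lt_le_trans r0 rz.
  apply: mulr_ge0 (expR_ge0 _); rewrite mulr_ge0 ?exprn_ge0 ?invr_ge0 ?(ltW z0)// subr_ge0.
  apply: dn_ge => // x /andP[x0 xz]; rewrite (le_trans (hK2 x _)) ?x0 ?(le_trans xz)//.
  by rewrite ler_wpM2l.
exists (3 * K3 * C), rho; split => // r.
have K3_ge0 : 0 <= K3.
  apply: mulr_ge0 (expR_ge0 _); apply: mulr_ge0 (n_ge0 _ rho0) _.
  by rewrite exprn_ge0 // invr_ge0 ltW.
rewrite le_eqVlt => /andP[/predU1P[<-|r0] rrho]; first by rewrite h0 expr0n mulr0.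
rewrite mulrAC; apply: hC => //; first by do ![apply: mulr_ge0 => //]; exact: ltW.
move=> x /andP[x0 xr]; apply: (le_trans (lown x x0)).
rewrite -mulrA ler_pM2l //; apply: (@le_trans _ _ (K3 * x ^+ 2)).
  by apply: nK3; rewrite x0 (le_trans xr).
by rewrite ler_wpM2l // ler_pXn2r ?nnegrE // ltW.
Qed.
End quadratic_bound.

(** * Gaussian solutions of the circular mean equation *)

Section gaussian.
Variable R : realType.
Implicit Types (f g h G E : R -> R) (r x t : R).

(* [a] is the limit superior of [h r / r ^ 2] at [0]. *)
Lemma limsup_ratio h (K rho : R) : (forall x, 0 <= h x) -> h 0 = 0 -> 0 < rho ->
  (forall r, 0 <= r <= rho -> h r <= K * r ^+ 2) ->
  exists2 a : R, 0 <= a & forall e d : R, 0 < e -> 0 < d ->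
    exists2 r, 0 < r < d & (a - e) * r ^+ 2 <= h r /\
      forall x, 0 <= x <= r -> h x <= (a + e) * x ^+ 2.
Proof.
move=> h_ge0 h0 rho0 hK.
pose A : set R := [set a | exists2 d : R, 0 < d &
  forall x, 0 <= x <= d -> h x <= a * x ^+ 2].
have AK : A K by exists rho.
have A0 : lbound A 0.
  move=> a [d d0 had]; have := had d; rewrite lexx (ltW d0) => /(_ isT) hd.
  by rewrite -(pmulr_lge0 _ (exprn_gt0 2 d0)) (le_trans (h_ge0 d)).
have infA : has_inf A by split; [exists K|exists 0].
exists (inf A) => [|e d e0 d0]; first by apply: lb_le_inf; [exists K|].
have [a' [d' d'0 hd'] a'e] := inf_adherent e0 infA.
have dd0 : 0 < Num.min (d / 2) d' by rewrite lt_min d'0 divr_gt0.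
(* As [inf A - e] lies outside [A], its bound fails at some [x] in every interval at 0. Taking
   [d / 2] gives [x < d] strictly, and [d'] keeps the upper bound for [a'] valid. *)
have /existsNP[x /not_implyP[/andP[x0 xd] /negP]] : ~ forall x,
    0 <= x <= Num.min (d / 2) d' -> h x <= (inf A - e) * x ^+ 2.
  move=> hx; have : A (inf A - e) by exists (Num.min (d / 2) d').
  by move=> /(ge_inf infA.2); rewrite lerBrDr gerDl leNgt e0.
rewrite -ltNge => hx.
have xn0 : 0 < x.
  by rewrite lt_neqAle x0 andbT; apply/eqP => x00; move: hx; rewrite -x00 h0 expr0n mulr0 ltxx.
move: xd; rewrite le_min => /andP[xd xd'].
exists x; first by rewrite xn0 (le_lt_trans xd) // ltr_pdivrMr // ltr_pMr // ltr1n.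
split => [|y /andP[y0 yx]]; first exact: ltW.
apply: (le_trans (hd' y _)); first by rewrite y0 (le_trans yx).
by rewrite ler_wpM2r ?sqr_ge0 // ltW.
Qed.

(** The upper bound goes through [1 / (1 + y)], as [(1 - y + y ^ 2) (1 + y) = 1 + y ^ 3]. *)
Lemma expR_N_bounds (y : R) : 0 <= y -> 1 - y <= expR (- y) <= 1 - y + y ^+ 2.
Proof.
move=> y0; rewrite expR_ge1Dx /= expRN.
have y1 : 0 < 1 + y by rewrite ltr_wpDr.
apply: (@le_trans _ _ (1 + y)^-1); first by rewrite lef_pV2 ?posrE ?expR_gt0 ?expR_ge1Dx.
rewrite -[_^-1]mul1r ler_pdivrMr // -subr_ge0.
by rewrite (_ : _ - _ = y ^+ 3) ?exprn_ge0 //; ring.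
Qed.

Lemma mul_dist_le (u v u' v' : R) : `|u| <= 1 -> `|v'| <= 1 ->
  `|u * v - u' * v'| <= `|u - u'| + `|v - v'|.
Proof.
move=> u1 v1; rewrite (_ : _ - _ = (u - u') * v' + u * (v - v')); last by ring.
by rewrite (le_trans (ler_normD _ _)) // !normrM lerD // ?ler_piMr ?ler_piMl.
Qed.

Lemma quad_norm_le g : continuous g -> `|quad g| <= quad (fun t => `|g t|).
Proof.
by move=> cg; apply: le_normr_Rintegral => //; exact: continuous_itv_integrable.
Qed.

(* Where [h r] is close to [a r ^ 2], the nonnegative function [(a + e) x ^ 2 - h x] has a
   small mean over [x = r cos t]: the limit superior is attained in mean at these radii. *)
Theorem circular_mean_fixpoint G : continuous G -> (forall x, `|G x| <= 1) -> G 0 = 1 ->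
  (forall r, 0 < r -> cross G r = pi / 2 * G r) ->
  exists2 a : R, 0 <= a & forall r, 0 <= r -> G r = expR (- (a * r ^+ 2)).
Proof.
move=> cG G1 G0 eqG; have [h hE] : exists h, h = fun x => 1 - G x by exists (fun x => 1 - G x).
have ch : continuous h by rewrite hE => x; cont.
have {}hE x : h x = 1 - G x by rewrite hE.
have h0 : h 0 = 0 by rewrite hE G0 subrr.
have h02 x : 0 <= h x <= 2.
  by have := G1 x; rewrite ler_norml hE => /andP[? ?]; apply/andP; split; lra.
have h_ge0 x : 0 <= h x by have /andP[] := h02 x.
have eqh r : 0 < r -> pi / 4 * h r = mean_cos h r - cross h r / 2.
  move=> r0; have ccr : continuous (fun t => h (r * cos t) * h (r * sin t)).
    by move=> t; cont.
  have cc : continuous (fun t => 1 - h (r * cos t)) by move=> t; cont.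
  have c1 : continuous (fun _ : R => 1 : R) by move=> t; cont.
  have chc : continuous (fun t => h (r * cos t)) by move=> t; cont.
  have chs : continuous (fun t => h (r * sin t)) by move=> t; cont.
  have cB : continuous (fun t => 1 - h (r * cos t) - h (r * sin t)) by move=> t; cont.
  (* Expand [(1 - h) (1 - h)]; by reflection the two linear terms have the same integral. *)
  have : cross G r = pi / 2 - mean_cos h r - mean_cos h r + cross h r.
    rewrite -{2}(quad_cos_sin r ch) -[pi / 2]mul1r -quad_cst.
    rewrite -(quadB c1 chc) -(quadB cc chs) -(quadD cB ccr).
    by apply: quad_ext => t _; rewrite !hE; ring.
  by rewrite eqG // hE; lra.
have [K [rho [rho0 hK]]] := quadratic_bound ch h02 h0 eqh.
have [a a0 ha] := limsup_ratio h_ge0 h0 rho0 hK.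
exists a => // r r0.
have [e eE] : exists e, e = fun x : R => expR (- (a * x ^+ 2)) by eexists.
have ce : continuous e by rewrite eE => x; cont.
have {}eE x : e x = expR (- (a * x ^+ 2)) by rewrite eE.
rewrite -eE.
have e01 x : `|e x| <= 1.
  by rewrite eE ger0_norm ?expR_ge0 // -expR0 ler_expR oppr_le0 mulr_ge0 ?sqr_ge0.
have [f fE] : exists f, f = fun x : R => `|G x - e x| by eexists.
have cf : continuous f by rewrite fE => x; cont.
have {}fE x : f x = `|G x - e x| by rewrite fE.
suff : f r = 0 by rewrite fE => /normr0_eq0/eqP; rewrite subr_eq0 => /eqP.
apply: (@subsolution_eq0 R f 2) r0 => //.
- move=> x; rewrite fE normr_ge0 /= (le_trans (ler_normB _ _)) //.
  by have := G1 x; have := e01 x; lra.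
- by rewrite fE eE G0 expr0n mulr0 oppr0 expR0 subrr normr0.
- move=> x x0.
  (* The Gaussian solves the same equation because [cos ^ 2 + sin ^ 2 = 1]. For two solutions
     bounded by 1, the distance of the products is at most the sum of the distances of the factors,
     so [f] is a subsolution. *)
  have crosse : cross e x = pi / 2 * e x.
    rewrite mulrC -quad_cst; apply: quad_ext => t _.
    rewrite !eE -expRD; congr expR.
    by rewrite !exprMn -opprD -mulrDr -mulrDr cos2Dsin2 mulr1.
  have : pi / 2 * f x <= 2 * mean_cos f x.
    pose F t := G (x * cos t) * G (x * sin t) - e (x * cos t) * e (x * sin t).
    have cF : continuous F by move=> t; rewrite /F; cont.
    have cfc : continuous (fun t => f (x * cos t)) by move=> t; cont.
    have cfs : continuous (fun t => f (x * sin t)) by move=> t; cont.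
    have qF : quad F = pi / 2 * (G x - e x).
      by rewrite quadB ?mulrBr -?eqG -?crosse // => t; cont.
    rewrite fE -[X in X * _](gtr0_norm (pihalf_gt0 R)) -normrM -qF.
    apply: (le_trans (quad_norm_le cF)).
    rewrite mulr_natl mulr2n -{2}(quad_cos_sin x cf) -(quadD cfc cfs).
    apply: quad_le => [t|t|t tI].
    + by rewrite /continuous_at; apply: cvg_norm; exact: cF.
    + by cont.
    + by rewrite !fE; exact: mul_dist_le.
  lra.
- move=> ep d ep0 d0; have p4 := pi_lt4 R.
  have ep6 : 0 < ep / 6 by rewrite divr_gt0.
  have a41 : 0 < 4 * a ^+ 2 + 1 by rewrite ltr_wpDl ?mulr_ge0 ?sqr_ge0.
  (* The last two bounds on [x] yield [4 a ^ 2 x ^ 2 <= ep]; the summand 1 keeps the denominator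
     positive when [a = 0]. *)
  have d'0 : 0 < Num.min d (Num.min 1 (ep / (4 * a ^+ 2 + 1))).
    by rewrite !lt_min d0 ltr01 divr_gt0.
  have [x /andP[x0]] := ha _ _ ep6 d'0; rewrite !lt_min => /and3P[xd x1 xe] [hx hub].
  exists x; first by rewrite x0.
  have x2 : 4 * a ^+ 2 * x ^+ 2 <= ep.
    apply: (@le_trans _ _ ((4 * a ^+ 2 + 1) * x)); last first.
      by rewrite mulrC -ler_pdivlMr // ltW.
    apply: ler_pM; rewrite ?sqr_ge0 ?mulr_ge0 ?sqr_ge0 ?lerDl //.
    by rewrite expr2 ler_piMr // ltW.
  (* Write [y = x cos t]. From [h y <= (a + ep / 6) y ^ 2] the distance of [h y] to [a y ^ 2] is at
     most [(a + ep / 3) y ^ 2 - h y], which can be integrated without absolute values; [a ^ 2 x ^ 4]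
     bounds the error of [1 - a y ^ 2] as an approximation of the Gaussian. *)
  have : mean_cos f x <= quad (fun t => (a + 2 * (ep / 6)) * x ^+ 2 * cos t ^+ 2 -
      h (x * cos t) + a ^+ 2 * x ^+ 4).
    apply: quad_le => [t|t|t tI]; [by cont..|].
    have c0 := cos_quad_ge0 tI.
    have xc : 0 <= x * cos t <= x.
      by rewrite mulr_ge0 ?(ltW x0) //= ler_piMr ?cos_le1 ?ltW.
    have := hub _ xc; have := h_ge0 (x * cos t).
    have y0 : 0 <= a * (x * cos t) ^+ 2 by rewrite mulr_ge0 ?sqr_ge0.
    have /andP[] := expR_N_bounds y0.
    have : (a * (x * cos t) ^+ 2) ^+ 2 <= a ^+ 2 * x ^+ 4.
      rewrite exprMn -exprM ler_wpM2l ?sqr_ge0 //.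
      by case/andP: xc => ? ?; rewrite ler_pXn2r ?nnegrE // ltW.
    rewrite fE eE hE exprMn; set w := expR _ => w1 w2 w3 h1 h2.
    by apply/ler_normlP; split; nra.
  rewrite quadD; [|by move=> t; cont..].
  rewrite quadB; [|by move=> t; cont..].
  rewrite quadZ; last by move=> t; cont.
  rewrite quad_cst quad_cos2 -/(mean_cos h x).
  have := eqh x x0; have : 0 <= cross h x by apply: quad_ge0 => t _; rewrite mulr_ge0.
  have := pi_gt0 R.
  move=> pi0 cr0 eqx /le_trans; apply.
  have X0 : 0 < x ^+ 2 by rewrite exprn_gt0.
  (* As [cross h x >= 0], the mean of [h] is at least [pi / 4 h x], and the terms in [a x ^ 2]
     cancel. What remains is [pi / 4 (ep / 2) x ^ 2] and [pi / 2 a ^ 2 x ^ 4], each at most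
     [ep / 2 x ^ 2]. *)
  have hx' : pi / 4 * ((a - ep / 6) * x ^+ 2) <= pi / 4 * h x.
    by rewrite ler_wpM2l // divr_ge0 // ltW.
  have e1 : pi / 4 * (ep / 2 * x ^+ 2) <= 1 * (ep / 2 * x ^+ 2).
    by rewrite ler_wpM2r ?mulr_ge0 ?sqr_ge0 ?divr_ge0 ?(ltW ep0)//; lra.
  have e2 : pi / 2 * (4 * a ^+ 2 * x ^+ 2 * x ^+ 2) <= 2 * (ep * x ^+ 2).
    apply: ler_pM; [by rewrite divr_ge0 // ltW| |lra|exact: ler_wpM2r (ltW X0) _ _ x2].
    by rewrite !mulr_ge0 ?sqr_ge0 // ltW.
  rewrite (_ : x ^+ 4 = x ^+ 2 * x ^+ 2); last by rewrite -exprD.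
  lra.
Qed.
End gaussian.

(** * Characteristic functions *)

Section characteristic_function.
Variables (R : realType) (m : probability (measurableTypeR R) R).
Implicit Types (f g : R -> R) (x t xi : R).

Lemma bounded_continuous_integrable g (B : R) : continuous g ->
  (forall x, `|g x| <= B) -> m.-integrable setT (EFin \o g).
Proof.
move=> cg gB; apply: measurable_bounded_integrable => //.
- by rewrite (le_lt_trans (probability_le1 m _)) // ltry.
- exact: continuous_measurable_fun.
- by exists B; split => [|M BM x _]; [exact: num_real|exact: le_trans (gB x) (ltW BM)].
Qed.

Lemma cos_norm_le1 x : `|cos x| <= 1.
Proof. by rewrite ler_norml cos_geN1 cos_le1. Qed.

Lemma sin_norm_le1 x : `|sin x| <= 1.
Proof. by rewrite ler_norml sin_geN1 sin_le1. Qed.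

Lemma cst1_integrable : m.-integrable setT (EFin \o (cst 1 : R -> R)).
Proof.
apply: (@bounded_continuous_integrable _ 1) => x; first exact: cst_continuous.
by rewrite /= normr1.
Qed.

Lemma probability_mean1 : \int[m]_x cst 1 x = 1.
Proof.
rewrite Rintegral_cst // mul1r -[RHS]/(fine 1%E); congr fine.
exact: probability_setT.
Qed.

Lemma probability_mean_le1 g : continuous g -> (forall x, `|g x| <= 1) ->
  `|\int[m]_x g x| <= 1.
Proof.
move=> cg g1.
apply: (le_trans (le_normr_Rintegral _ (bounded_continuous_integrable cg g1))) => //.
rewrite -[leRHS]probability_mean1.
apply: le_Rintegral => //.
  apply: (@bounded_continuous_integrable _ 1); first by move=> x; cont.
  by move=> x; rewrite normr_id.
exact: cst1_integrable.
Qed.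

Lemma mean_continuous (g : R -> R) : continuous g -> (forall x, `|g x| <= 1) ->
  continuous (fun xi => \int[m]_x g (xi * x)).
Proof.
move=> cg g1 xi.
have cgl a : continuous (fun x => g (a * x)) by move=> x; cont.
have cgr a : continuous (fun x => g (x * a)) by move=> x; cont.
have xiI : xi \in (`]xi - 1, xi + 1[%classic : set R).
  by rewrite inE /= in_itv /= ltrBlDr ltrDl ltr01.
apply: (@continuity_under_integral R _ _ m (fun xi x => g (xi * x)) setT _ (xi - 1) (xi + 1)
  _ _ (cst 1) _ _ xi xiI) => //.
- by move=> a _; apply: (@bounded_continuous_integrable _ 1).
- by apply: aeW => y _ a _; exact: cgr.
- exact: cst1_integrable.
- by move=> a _; apply: aeW => y _ /=.
Qed.

Definition re_charfun xi : R := \int[m]_x cos (xi * x).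
Definition im_charfun xi : R := \int[m]_x sin (xi * x).

Lemma charfunE xi : charfun m xi = (re_charfun xi +i* im_charfun xi)%C.
Proof. by []. Qed.

Lemma re_charfunN xi : re_charfun (- xi) = re_charfun xi.
Proof. by apply: eq_Rintegral => x _; rewrite mulNr cosN. Qed.

Lemma im_charfunN xi : im_charfun (- xi) = - im_charfun xi.
Proof.
have isin : m.-integrable setT (EFin \o (fun x => sin (xi * x))).
  apply: (@bounded_continuous_integrable _ 1) => x; last exact: sin_norm_le1.
  by cont.
rewrite -[RHS]mulN1r -(RintegralZl (-1) measurableT isin).
by apply: eq_Rintegral => x _; rewrite mulNr sinN mulN1r.
Qed.

Lemma re_charfun0 : re_charfun 0 = 1.
Proof.
rewrite -[RHS]probability_mean1.
by apply: eq_Rintegral => x _; rewrite mul0r cos0.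
Qed.

Lemma re_charfun_continuous : continuous re_charfun.
Proof. exact: mean_continuous (@continuous_cos R) cos_norm_le1. Qed.

Lemma im_charfun_continuous : continuous im_charfun.
Proof. exact: mean_continuous (@continuous_sin R) sin_norm_le1. Qed.

Lemma re_charfun_le1 xi : `|re_charfun xi| <= 1.
Proof.
apply: (@probability_mean_le1 (fun x => cos (xi * x))) => x; first by cont.
exact: cos_norm_le1.
Qed.

End characteristic_function.

(** * Signed powers of cosine and sine *)

Section kac.
Variable R : realType.
Implicit Types (f g P Q : R -> R) (x t r p q xi : R).
Local Open Scope complex_scope.

Lemma absX_continuous q : 0 < q -> continuous (fun x => `|x| `^ q).
Proof.
move=> q0 x; have [->|x0] := eqVneq x 0; last first.
  apply: (@continuous_comp _ _ _ (fun x => `|x|) (fun x => x `^ q)).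
    exact: norm_continuous.
  apply/differentiable_continuous/derivable1_diffP.
  by apply: derivable_powR; rewrite in_itv /= andbT normr_gt0.
rewrite /continuous_at normr0 powR0 ?gt_eqF//; apply/cvgr0Pnorm_le => e e0.
near=> u; rewrite ger0_norm ?powR_ge0 //.
apply: (@le_trans _ _ ((e `^ q^-1) `^ q)); last first.
  by rewrite -powRrM mulVf ?gt_eqF // powRr1 // ltW.
apply: ge0_ler_powR; rewrite ?nnegrE ?powR_ge0 ?(ltW q0) //.
by near: u; apply: near0_norm_le; rewrite powR_gt0.
Unshelve. all: end_near. Qed.

Lemma signed_powR_continuous p : 0 <= p -> continuous (fun x => x * `|x| `^ p).
Proof.
rewrite le_eqVlt => /predU1P[<-|p0] x.
  rewrite (_ : (fun _ => _) = id); first exact: cvg_id.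
  by apply/funext => y; rewrite powRr0 mulr1.
by apply: cvgM; [exact: cvg_id|exact: absX_continuous].
Qed.

Lemma cosp_continuous p : 0 <= p -> continuous (cosp p : R -> R).
Proof.
move=> p0 t; apply: (@continuous_comp _ _ _ cos (fun x => x * `|x| `^ p)).
  exact: continuous_cos.
exact: signed_powR_continuous.
Qed.

Lemma sinp_continuous p : 0 <= p -> continuous (sinp p : R -> R).
Proof.
move=> p0 t; apply: (@continuous_comp _ _ _ sin (fun x => x * `|x| `^ p)).
  exact: continuous_sin.
exact: signed_powR_continuous.
Qed.

Lemma cospDpihalf p t : cosp p (t + pi / 2) = - sinp p t.
Proof. by rewrite /cosp /sinp cosDpihalf normrN mulNr. Qed.

Lemma sinpDpihalf p t : sinp p (t + pi / 2) = cosp p t.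
Proof. by rewrite /cosp /sinp sinDpihalf. Qed.

Lemma cospDpi p t : cosp p (t + pi) = - cosp p t.
Proof. by rewrite /cosp cosDpi normrN mulNr. Qed.

Lemma sinpDpi p t : sinp p (t + pi) = - sinp p t.
Proof. by rewrite /sinp sinDpi normrN mulNr. Qed.

Lemma powR1D p x : 0 <= p -> 0 <= x -> x `^ (1 + p) = x * x `^ p.
Proof.
move=> p0 x0; have np : (1 + p == 0) ==> (x != 0) by rewrite gt_eqF // ltr_wpDr.
by rewrite (powRD np) powRr1.
Qed.

(** This identity is behind the substitution [xi = r ^ (1 + p)]: it turns [xi cosp p t] into
    [(r cos t) ^ (1 + p)] on the first quadrant, and likewise for the sine. *)
Lemma mulr_powR_scale p r x : 0 <= p -> 0 <= r -> 0 <= x ->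
  r `^ (1 + p) * (x * `|x| `^ p) = (r * x) `^ (1 + p).
Proof.
move=> p0 r0 x0; by rewrite powRM // ger0_norm // -(powR1D p0 x0).
Qed.

(** * Characteristic functions that solve the equation *)

Section solution.
Variables (m : probability (measurableTypeR R) R) (p : R).
Hypotheses (p0 : 0 <= p) (kac : kac_solutions p (charfun m)).
Let P := re_charfun m.
Let Q := im_charfun m.

Let cP : continuous P. Proof. exact: re_charfun_continuous. Qed.
Let cQ : continuous Q. Proof. exact: im_charfun_continuous. Qed.

Let kac_re_im xi :
  (\int[lebesgue_measure]_(t in `[0%R, (2 * pi)%R])
     (P (xi * cosp p t) * P (xi * sinp p t) - Q (xi * cosp p t) * Q (xi * sinp p t)))%R
     = 2 * pi * P xi /\
  (\int[lebesgue_measure]_(t in `[0%R, (2 * pi)%R])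
     (P (xi * cosp p t) * Q (xi * sinp p t) + Q (xi * cosp p t) * P (xi * sinp p t)))%R
     = 2 * pi * Q xi.
Proof.
have := kac xi; rewrite charfunE /Cintegral => /eqP.
rewrite eq_complex /= => /andP[/eqP re /eqP im].
have pn0 : 2 * pi != 0 :> R by rewrite mulf_neq0 // gt_eqF // pi_gt0.
rewrite /P /Q -re -im !mul0r subr0 addr0 !mulVKf //.
Qed.

Let cc : continuous (cosp p : R -> R). Proof. exact: cosp_continuous. Qed.
Let cs : continuous (sinp p : R -> R). Proof. exact: sinp_continuous. Qed.

Lemma cospD3pihalf t : cosp p (t + (pi + pi / 2)) = sinp p t.
Proof. by rewrite [pi + _]addrC addrA cospDpi cospDpihalf opprK. Qed.

Lemma sinpD3pihalf t : sinp p (t + (pi + pi / 2)) = - cosp p t.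
Proof. by rewrite [pi + _]addrC addrA sinpDpi sinpDpihalf. Qed.

(* The four quadrants carry the sign pairs [(c, s), (-s, c), (-c, -s), (s, -c)], over
   which the imaginary parts cancel. *)
Lemma kac_im0 xi : im_charfun m xi = 0.
Proof.
have [_] := kac_re_im xi; rewrite integral_four_quadrants; last by move=> t; cont.
rewrite (_ : quad _ = quad (fun=> 0)); last first.
  apply: quad_ext => t _.
  rewrite !(cospDpihalf, sinpDpihalf, cospDpi, sinpDpi, cospD3pihalf, sinpD3pihalf).
  rewrite !mulrN /P /Q !re_charfunN !im_charfunN.
  move: (re_charfun m _) (re_charfun m _) (im_charfun m _) (im_charfun m _).
  by move=> u v w z; ring.
rewrite quad_cst mul0r => /esym/eqP; rewrite mulf_eq0 => /orP[|/eqP //].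
by rewrite mulf_eq0 pnatr_eq0 /= gt_eqF ?pi_gt0.
Qed.

(** [P] is even and [Q] odd, so the products of [P] agree on the four quadrants, while those of [Q]
    alternate in sign and cancel. *)
Lemma kac_re xi : quad (fun t => re_charfun m (xi * cosp p t) *
    re_charfun m (xi * sinp p t)) = pi / 2 * re_charfun m xi.
Proof.
have [+ _] := kac_re_im xi; rewrite integral_four_quadrants; last by move=> t; cont.
rewrite (_ : quad _ = 4 * quad (fun t => P (xi * cosp p t) * P (xi * sinp p t))).
  by rewrite /P; move: (quad _) (re_charfun m _) => u v e; lra.
rewrite -quadZ; last by move=> t; cont.
apply: quad_ext => t _.
rewrite !(cospDpihalf, sinpDpihalf, cospDpi, sinpDpi, cospD3pihalf, sinpD3pihalf).
rewrite !mulrN /P /Q !re_charfunN !im_charfunN.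
move: (re_charfun m _) (re_charfun m _) (im_charfun m _) (im_charfun m _).
by move=> u v w z; ring.
Qed.

Lemma kac_stable_form : stable_form (2 / (1 + p)) (charfun m).
Proof.
have p1 : 0 < 1 + p by rewrite ltr_wpDr.
have [G GE] : exists G, G = fun x => re_charfun m (`|x| `^ (1 + p)) by eexists.
have cG : continuous G.
  rewrite GE => x; apply: (@continuous_comp _ _ _ (fun x => `|x| `^ (1 + p)) P).
    exact: absX_continuous.
  exact: cP.
have {}GE x : G x = re_charfun m (`|x| `^ (1 + p)) by rewrite GE.
have [|||a a0 Ga] := circular_mean_fixpoint cG.
- by move=> x; rewrite GE re_charfun_le1.
- by rewrite GE normr0 powR0 ?gt_eqF // re_charfun0.
- move=> r r0; rewrite GE -kac_re; apply: quad_ext => t tI.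
  have c0 := cos_quad_ge0 tI; have s0 := sin_quad_ge0 tI.
  have scale x : 0 <= x -> `|r| `^ (1 + p) * (x * `|x| `^ p) = `|r * x| `^ (1 + p).
    by move=> x0; rewrite mulr_powR_scale // normrM [in RHS](ger0_norm x0).
  by rewrite !GE -(scale _ c0) -(scale _ s0).
exists a => //; apply/funext => xi; rewrite charfunE kac_im0; congr (_ +i* _).
(* Undo the substitution; evenness of the real part covers negative [xi]. The square in the Gaussian
   then becomes the exponent [2 / (1 + p)]. *)
have -> : re_charfun m xi = G (`|xi| `^ (1 + p)^-1).
  rewrite GE ger0_norm ?powR_ge0 // -powRrM mulVf ?gt_eqF // powRr1 //.
  by case: ger0P; rewrite ?re_charfunN.
rewrite Ga ?powR_ge0 //; congr (expR (- (a * _))).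
by rewrite -powR_mulrn ?powR_ge0 // -powRrM mulrC.
Qed.
End solution.

(** The exponent [q = 2 / (1 + p)] turns [|cosp|] and [|sinp|] into [cos ^ 2] and [sin ^ 2], so the
    integrand does not depend on the angle. *)
Lemma stable_form_kac p a : 0 <= p ->
  kac_solutions p (fun xi : R => (expR (- (a * `|xi| `^ (2 / (1 + p)))))%:C).
Proof.
move=> p0 xi; have p1 : 0 < 1 + p by rewrite ltr_wpDr.
set q := 2 / (1 + p).
have scale x : `|xi * (x * `|x| `^ p)| `^ q = `|xi| `^ q * x ^+ 2.
  have -> : `|xi * (x * `|x| `^ p)| = `|xi| * `|x| `^ (1 + p).
    by rewrite powR1D // !normrM [X in _ * (_ * X)]ger0_norm ?powR_ge0.
  rewrite powRM ?powR_ge0 // -powRrM /q mulrCA divff ?gt_eqF // mulr1.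
  by rewrite powR_mulrn // real_normK ?num_real.
have prod t : (expR (- (a * `|xi * cosp p t| `^ q)))%:C * (expR (- (a * `|xi * sinp p t| `^ q)))%:C
    = (expR (- (a * `|xi| `^ q)))%:C.
  rewrite -rmorphM -expRD; congr ((expR _)%:C).
  by rewrite /cosp /sinp !scale -opprD -mulrDr -mulrDr cos2Dsin2 mulr1.
have mean_cst (c : R) : (\int[lebesgue_measure]_(t in `[0%R, (2 * pi)%R]) c)%R = 2 * pi * c.
  have pi0 : 0 < 2 * pi :> R by rewrite mulr_gt0 // pi_gt0.
  have dF t : 0 <= t <= 2 * pi -> is_derive t 1 (fun t : R => c * t) c.
    by move=> _; apply: is_derive_eq; rewrite /GRing.scale /=; ring.
  have cF : continuous (fun _ : R => c) by move=> x; exact: cvg_cst.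
  by rewrite (integral_itv_antiderivative pi0 cF dF) mulr0 subr0 mulrC.
rewrite /Cintegral; under eq_Rintegral do rewrite prod.
under [X in _ +i* X]eq_Rintegral do rewrite prod.
rewrite !mean_cst mulr0; apply/eqP; rewrite eq_complex /=.
rewrite mul0r subr0 mulr0 mul0r addr0 eqxx andbT mulKf //.
by rewrite mulf_neq0 // gt_eqF // pi_gt0.
Qed.
End kac.

Unset Implicit Arguments.

Theorem corollary2 (R : realType) (alpha : R) (alpha_gt0 : 0 < alpha)
    (alpha_le2 : alpha <= 2) (p : R) (pE : p = 2 / alpha - 1) :
  charfuns R `&` kac_solutions p = charfuns R `&` stable_form alpha.
Proof.
have p0 : 0 <= p by rewrite pE subr_ge0 ler_pdivlMr // mul1r.
have alphaE : alpha = 2 / (1 + p) by rewrite pE addrC subrK invf_div mulrCA divff ?mulr1.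
rewrite alphaE; apply/seteqP; split => phi [charphi].
  move=> kac; split => //; case: charphi kac => m -> kac.
  exact: kac_stable_form.
by case=> a a0 phiE; split => //; rewrite phiE; exact: stable_form_kac.
Qed.
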